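(* Let $R$ be a commutative ring with identity and let $M$ be a finitely generated Gorenstein projective $R$-module. If $M^*=\mathrm{Hom}_R(M,R)$ has finite Gorenstein projective dimension, then $M$ is super finitely presented and $M^*$ is Gorenstein projective.
   Context: An $R$-module $M$ is super finitely presented if there is an exact sequence $\cdots\to P_n\to\cdots\to P_1\to P_0\to M\to 0$ with every $P_i$ finitely generated projective. An $R$-module $M$ is Gorenstein projective if there is an exact complex of projective $R$-modules $\cdots\to P_1\to P_0\to P^0\to P^1\to\cdots$ with $M\cong\mathrm{im}(P_0\to P^0)$ such that $\mathrm{Hom}_R(-,Q)$ leaves it exact for every projective $R$-module $Q$. The Gorenstein projective dimension is the minimal length of a resolution by Gorenstein projective modules ($\infty$ if none is finite). *)

(* Defs.v *)
From HB Require Import structures.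
From mathcomp Require Import all_boot all_order all_algebra.
From mathcomp Require Import boolp classical_sets functions.
From mathcomp Require Import ring.
Set Implicit Arguments. Unset Strict Implicit. Unset Printing Implicit Defensive.
Import GRing.Theory.
Local Open Scope ring_scope.

Section Dual.
Variables (R : comPzRingType) (M : lmodType R).
Definition linform_pred : {pred M -> R^o} := fun f => `[< linear f >].
Lemma linform_submod_closed : submod_closed linform_pred.
Proof.
split.
  by apply/asboolP => a u v /=; rewrite /GRing.zero /= scaler0 addr0.
move=> k f g /asboolP lf /asboolP lg; apply/asboolP => a u v /=.
rewrite /GRing.add /GRing.scale /= lf lg /=.
change (k * (a * f u + f v) + (a * g u + g v) = a * (k * f u + g u) + (k * f v + g v) :> R).
ring.
Qed.

HB.instance Definition _ := GRing.isSubmodClosed.Build R (M -> R^o) linform_pred linform_submod_closed.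
Record dual := Dual { dual_val : M -> R^o; _ : dual_val \in linform_pred }.
HB.instance Definition _ := [isSub for dual_val].
HB.instance Definition _ := [Choice of dual by <:].
HB.instance Definition _ := [SubChoice_isSubLmodule of dual by <:].
End Dual.

Section Homological.
Variable R : comPzRingType.

Definition fin_gen (M : lmodType R) : Prop :=
  exists (n : nat) (v : 'I_n -> M),
    forall x : M, exists c : 'I_n -> R, x = \sum_(i < n) c i *: v i.

Definition projective (P : lmodType R) : Prop :=
  forall (N N' : lmodType R) (g : {linear N -> N'}) (f : {linear P -> N'}),
    (forall y : N', exists x : N, g x = y) ->
    exists h : {linear P -> N}, forall x : P, g (h x) = f x.

Definition exact_Z (C : int -> lmodType R) (d : forall i, {linear C i -> C (i + 1)})
  : Prop :=
  forall (i : int) (x : C (i + 1)), d (i + 1) x = 0 <-> exists y : C i, d i y = x.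

Definition Hom_exact_Z (C : int -> lmodType R) (d : forall i, {linear C i -> C (i + 1)})
  (Q : lmodType R) : Prop :=
  forall (i : int) (f : {linear C (i + 1) -> Q}),
    (forall y : C i, f (d i y) = 0) ->
    exists g : {linear C (i + 1 + 1) -> Q}, forall x : C (i + 1), f x = g (d (i + 1) x).

(* Gorenstein projective: M is isomorphic to the image of d 0 : C 0 -> C 1
   (C 0 = P_0, C 1 = P^0) in a totally acyclic complex of projectives. *)
Definition gorenstein_projective (M : lmodType R) : Prop :=
  exists (C : int -> lmodType R) (d : forall i, {linear C i -> C (i + 1)}),
    [/\ exact_Z d,
        (forall i, projective (C i)),
        (forall Q : lmodType R, projective Q -> Hom_exact_Z d Q) &
        (exists phi : {linear M -> C (0 + 1)},
          injective phi /\
          forall y : C (0 + 1), (exists x : M, phi x = y) <-> (exists z : C 0, d 0 z = y))].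

Definition Gpd_le (M : lmodType R) (n : nat) : Prop :=
  exists (G : nat -> lmodType R) (e : forall i, {linear G i.+1 -> G i})
         (eps : {linear G 0 -> M}),
    [/\ (forall i, gorenstein_projective (G i)),
        (forall i, (n < i)%N -> forall x : G i, x = 0),
        (forall y : M, exists x : G 0, eps x = y),
        (forall x : G 0, eps x = 0 <-> exists y : G 1, e 0%N y = x) &
        (forall (i : nat) (x : G i.+1), e i x = 0 <-> exists y : G i.+2, e i.+1 y = x)].

Definition finite_Gpd (M : lmodType R) : Prop := exists n : nat, Gpd_le M n.

Definition super_fp (M : lmodType R) : Prop :=
  exists (P : nat -> lmodType R) (e : forall i, {linear P i.+1 -> P i})
         (eps : {linear P 0 -> M}),
    [/\ (forall i, and (fin_gen (P i)) (projective (P i))),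
        (forall y : M, exists x : P 0, eps x = y),
        (forall x : P 0, eps x = 0 <-> exists y : P 1, e 0%N y = x) &
        (forall (i : nat) (x : P i.+1), e i x = 0 <-> exists y : P i.+2, e i.+1 y = x)].

End Homological.

(* Main.v *)
(** For a finitely generated Gorenstein projective [M], embed [M] in a projective
    with Gorenstein projective cokernel; since [M] is finitely generated the
    embedding passes through some [R^m], and [N = R^m / M] is again finitely
    generated Gorenstein projective. Dualizing [0 -> M -> R^m -> N -> 0] gives an
    exact [0 -> N^* -> (R^m)^* -> M^* -> 0], so iterating shows that [M^*] is
    super finitely presented, and comparing with the biduals shows that [M] is
    reflexive. Reflexivity of [N] says that maps from [N^*] to projectives extend
    to [(R^m)^*], i.e. [Ext^1(M^*, Q) = 0]; hence [M^*] is Gorenstein projective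
    as soon as [N^*] is, and [N^*] has smaller Gorenstein dimension than [M^*].
    Induction on the dimension gives the second claim, and the first follows by
    applying the super finite presentation of duals to [M^*], whose
    dual is [M].

    Gorenstein projectivity is handled as membership in a class whose members have
    vanishing [Ext^1] into projectives and are both a subobject and a quotient of
    a projective with third term in the class. The extension closure of the
    retracts of the members of such a class is again such a class, which gives
    stability under extensions and direct summands without infinite sums. *)

Require Import Defs.
From HB Require Import structures.
From mathcomp Require Import all_boot all_order all_algebra.
From mathcomp Require Import boolp classical_sets functions.
From mathcomp Require Import fsbigop.
Set Implicit Arguments. Unset Strict Implicit. Unset Printing Implicit Defensive.
Import GRing.Theory.
Local Open Scope ring_scope.

Lemma dependent_choice_fun T (U : T -> Type) (P : forall t, U t -> Prop) :
  (forall t, exists u, P t u) -> exists f : forall t, U t, forall t, P t (f t).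
Proof. by move=> /(_ _)/cid H; exists (fun t => sval (H t)) => t; case: (H t). Qed.

(** * Linear maps: factorizations, kernels and cokernels *)

Section LinearMaps.
Variable R : comPzRingType.
Implicit Types A B C X Q : lmodType R.

Lemma linear_exists A B (f : A -> B) :
  linear f -> exists g : {linear A -> B}, forall x, g x = f x.
Proof.
move=> lf; pose m := GRing.isLinear.Build R A B _ f lf.
pose F : {linear A -> B} := HB.pack f m.
by exists F.
Qed.

Definition onto A B (f : A -> B) := forall y, exists x, f x = y.

Definition ses A B C (f : {linear A -> B}) (g : {linear B -> C}) :=
  [/\ injective f, onto g & forall b, g b = 0 <-> exists a, f a = b].

Lemma inj0 A B (f : {linear A -> B}) :
  (forall x, f x = 0 -> x = 0) -> injective f.
Proof.
by move=> H x y e; apply/eqP; rewrite -subr_eq0; apply/eqP/H; rewrite linearB e subrr.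
Qed.

Lemma inj_eq0 A B (f : {linear A -> B}) x : injective f -> f x = 0 -> x = 0.
Proof. by move=> fi e; apply: fi; rewrite e linear0. Qed.

Lemma ses_comp0 A B C (f : {linear A -> B}) (g : {linear B -> C}) a :
  ses f g -> g (f a) = 0.
Proof. by move=> [_ _ H]; apply/H; exists a. Qed.

Lemma factor_surj A B Q (s : {linear A -> B}) (h : {linear A -> Q}) :
  onto s -> (forall a, s a = 0 -> h a = 0) ->
  exists k : {linear B -> Q}, forall a, k (s a) = h a.
Proof.
move=> ss hs; have [r rE] := dependent_choice_fun ss.
have hr a b : s a = s b -> h a = h b.
  by move=> e; apply/eqP; rewrite -subr_eq0 -linearB hs // linearB e subrr.
have [|k kE] := @linear_exists _ _ (fun b => h (r b)).
  by move=> c u v; rewrite -linearP; apply: hr; rewrite linearP !rE.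
by exists k => a; rewrite kE; apply: hr; rewrite rE.
Qed.

Lemma factor_inj A B X (f : {linear A -> B}) (h : {linear X -> B}) :
  injective f -> (forall x, exists a, f a = h x) ->
  exists k : {linear X -> A}, forall x, f (k x) = h x.
Proof.
move=> fi /dependent_choice_fun[r rE].
have [|k kE] := @linear_exists _ _ r.
  by move=> c u v; apply: fi; rewrite linearP !rE linearP.
by exists k => x; rewrite kE rE.
Qed.

Section Kernel.
Variables (A B : lmodType R) (f : {linear A -> B}).
Definition ker_pred : {pred A} := fun a => f a == 0.
Lemma ker_submod_closed : submod_closed ker_pred.
Proof.
split; first by rewrite unfold_in linear0.
by move=> c u v; rewrite !unfold_in linearP => /eqP-> /eqP->; rewrite scaler0 addr0.
Qed.
HB.instance Definition _ := GRing.isSubmodClosed.Build R A ker_pred ker_submod_closed.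
Record kernel := Kernel { kernel_val : A; _ : kernel_val \in ker_pred }.
HB.instance Definition _ := [isSub for kernel_val].
HB.instance Definition _ := [Choice of kernel by <:].
HB.instance Definition _ := [SubChoice_isSubLmodule of kernel by <:].
End Kernel.

Lemma kernel_exists A B (f : {linear A -> B}) :
  exists (K : lmodType R) (i : {linear K -> A}),
    injective i /\ forall a, f a = 0 <-> exists k, i k = a.
Proof.
exists (kernel f : lmodType R), (val : {linear kernel f -> A}).
split; first exact: val_inj.
move=> a; split=> [/eqP fa|[[k kP] <-]]; last exact/eqP.
by exists (Kernel (fa : a \in ker_pred f)).
Qed.

Section Cokernel.
Variables (A B : lmodType R) (f : {linear A -> B}).
Let eqv (x y : B) := exists a, f a = x - y.
Let eqv_refl x : eqv x x. Proof. by exists 0; rewrite linear0 subrr. Qed.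
Let eqv_sym x y : eqv x y -> eqv y x.
Proof. by move=> [a e]; exists (- a); rewrite linearN e opprB. Qed.
Let eqv_trans x y z : eqv x y -> eqv y z -> eqv x z.
Proof. by move=> [a e] [b e']; exists (a + b); rewrite linearD e e' addrA subrK. Qed.
Let cls x : pred B := fun y => `[< eqv x y >].
Let repr x := choose (cls x) x.
Let reprP x : eqv x (repr x).
Proof. by apply/asboolP; apply: (@chooseP _ (cls x)); apply/asboolP. Qed.
(** [choose] depends on a predicate and on a default point. Equivalent points have equal class
    predicates, and [choose_id] then removes the dependence on the default. *)
Let repr_eq x y : eqv x y -> repr x = repr y.
Proof.
move=> exy; rewrite /repr.
have/eq_choose -> : cls x =1 cls y.
  move=> z; apply/asboolP/asboolP; last exact: eqv_trans.
  by apply: eqv_trans; apply: eqv_sym.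
by apply: choose_id; apply/asboolP => //; apply: eqv_sym.
Qed.
Let reprK x : repr (repr x) == repr x.
Proof. by apply/eqP/esym/repr_eq/reprP. Qed.
(** The quotient of [B] by the image of [f] is encoded as the subtype of canonical representatives.
    The operations act on representatives and then project; since projecting first changes nothing,
    the module laws descend from [B]. *)
Record coker := Coker { coker_val : B; _ : repr coker_val == coker_val }.
HB.instance Definition _ := [isSub for coker_val].
HB.instance Definition _ := [Choice of coker by <:].
Definition coker_proj x : coker := Coker (reprK x).
Let proj_eq x y : eqv x y -> coker_proj x = coker_proj y.
Proof. by move=> e; apply: val_inj; apply: repr_eq. Qed.
Let val_proj x : eqv (val (coker_proj x)) x.
Proof. exact/eqv_sym/reprP. Qed.
Let proj_val (t : coker) : coker_proj (val t) = t.
Proof. by apply: val_inj; apply/eqP; case: t. Qed.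
Let add (s t : coker) : coker := coker_proj (val s + val t).
Let opp (s : coker) : coker := coker_proj (- val s).
Let scale c (s : coker) : coker := coker_proj (c *: val s).
Let addE x y : add (coker_proj x) (coker_proj y) = coker_proj (x + y).
Proof.
apply: proj_eq; have [a ea] := val_proj x; have [b eb] := val_proj y.
by exists (a + b); rewrite linearD ea eb opprD addrACA.
Qed.
Let oppE x : opp (coker_proj x) = coker_proj (- x).
Proof.
apply: proj_eq; have [a ea] := val_proj x.
by exists (- a); rewrite linearN ea opprD.
Qed.
Let scaleE c x : scale c (coker_proj x) = coker_proj (c *: x).
Proof.
apply: proj_eq; have [a ea] := val_proj x.
by exists (c *: a); rewrite linearZ /= ea scalerBr.
Qed.
Let addA : associative add.
Proof.
by move=> s t u; rewrite -(proj_val s) -(proj_val t) -(proj_val u) !addE addrA.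
Qed.
Let addC : commutative add.
Proof. by move=> s t; rewrite /add addrC. Qed.
Let add0 : left_id (coker_proj 0) add.
Proof. by move=> s; rewrite -(proj_val s) addE add0r. Qed.
Let addN : left_inverse (coker_proj 0) opp add.
Proof. by move=> s; rewrite -(proj_val s) oppE addE addNr. Qed.
HB.instance Definition _ := GRing.isZmodule.Build coker addA addC add0 addN.
Let scaleA a b s : scale a (scale b s) = scale (a * b) s.
Proof. by rewrite -(proj_val s) !scaleE scalerA. Qed.
Let scale1 : left_id 1 scale.
Proof. by move=> s; rewrite -(proj_val s) !scaleE scale1r. Qed.
Let scaleDr : right_distributive scale +%R.
Proof.
move=> c s t; rewrite -(proj_val s) -(proj_val t).
by rewrite [_ + _]addE !scaleE [RHS]addE scalerDr.
Qed.
Let scaleDl s : {morph scale^~ s : a b / a + b}.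
Proof. by move=> a b; rewrite -(proj_val s) !scaleE [RHS]addE scalerDl. Qed.
HB.instance Definition _ :=
  GRing.Zmodule_isLmodule.Build R coker scaleA scale1 scaleDr scaleDl.
Lemma coker_proj_is_linear : linear coker_proj.
Proof. by move=> c x y; rewrite -addE -scaleE. Qed.
Lemma coker_proj_surj t : exists x, coker_proj x = t.
Proof. by exists (val t). Qed.
Lemma coker_proj_eq0 x : coker_proj x = 0 <-> exists a, f a = x.
Proof.
split=> [|[a e]]; last by apply: proj_eq; exists a; rewrite subr0.
move=> /(congr1 val)/= e; have [a ea] := reprP x; have [b eb] := reprP 0.
exists (a - b); rewrite linearB ea eb e.
by rewrite sub0r opprK subrK.
Qed.
End Cokernel.

Lemma cokernel_exists A B (f : {linear A -> B}) :
  exists (C : lmodType R) (q : {linear B -> C}),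
    onto q /\ forall b, q b = 0 <-> exists a, f a = b.
Proof.
have [q qE] := linear_exists (coker_proj_is_linear f).
exists (coker f : lmodType R), q; split=> b; last by rewrite qE; apply: coker_proj_eq0.
by have [x <-] := coker_proj_surj b; exists x.
Qed.
End LinearMaps.

(** * Binary direct sums *)

Section ProductMaps.
Variable R : comPzRingType.
Implicit Types A B X P : lmodType R.

Lemma linear_pair A B X (f : {linear X -> A}) (g : {linear X -> B}) :
  exists h : {linear X -> (A * B)%type}, forall x, h x = (f x, g x).
Proof. by apply: linear_exists => c x y; rewrite !linearP. Qed.

Lemma linear_copair A B X (f : {linear A -> X}) (g : {linear B -> X}) :
  exists h : {linear (A * B)%type -> X}, forall a b, h (a, b) = f a + g b.
Proof.
have [|h hE] := @linear_exists R (A * B)%type X (fun p => f p.1 + g p.2).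
  by move=> c [a b] [a' b'] /=; rewrite !linearP scalerDr addrACA.
by exists h.
Qed.

Lemma linear_inl A B : exists h : {linear A -> (A * B)%type}, forall a, h a = (a, 0).
Proof.
by apply: linear_exists => c x y; congr (_, _); rewrite /= scaler0 addr0.
Qed.

Lemma linear_inr A B : exists h : {linear B -> (A * B)%type}, forall b, h b = (0, b).
Proof.
by apply: linear_exists => c x y; congr (_, _); rewrite /= scaler0 addr0.
Qed.

Lemma linear_fst A B : exists h : {linear (A * B)%type -> A}, forall a b, h (a, b) = a.
Proof.
have [|h hE] := @linear_exists R (A * B)%type A fst; first by [].
by exists h => a b; rewrite hE.
Qed.

Lemma linear_snd A B : exists h : {linear (A * B)%type -> B}, forall a b, h (a, b) = b.
Proof.
have [|h hE] := @linear_exists R (A * B)%type B snd; first by [].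
by exists h => a b; rewrite hE.
Qed.

Lemma projective_prod P P' :
  projective P -> projective P' -> projective (P * P')%type.
Proof.
move=> pP pP' N N' g f gs.
have [i iE] := linear_inl P P'; have [j jE] := linear_inr P P'.
have [h hE] := pP _ _ g (f \o i : {linear P -> N'}) gs.
have [h' h'E] := pP' _ _ g (f \o j : {linear P' -> N'}) gs.
have [k kE] := linear_copair h h'.
exists k => -[x y]; rewrite kE linearD hE h'E /= -linearD iE jE.
by congr (f (_, _)); rewrite ?addr0 ?add0r.
Qed.

Lemma ses_split_inl A B :
  exists (i : {linear A -> (A * B)%type}) (p : {linear (A * B)%type -> B}), ses i p.
Proof.
have [i iE] := linear_inl A B; have [p pE] := linear_snd A B.
exists i, p; split.
- by move=> x y; rewrite !iE => -[].
- by move=> y; exists (0, y); rewrite pE.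
- move=> [x y]; rewrite pE; split=> [->|[a]]; first by exists x; rewrite iE.
  by rewrite iE => -[].
Qed.

End ProductMaps.

(** * Vanishing of [Ext^1] into projectives *)

Section Extensions.
Variable R : comPzRingType.
Implicit Types A B C X Y Z P Q K G : lmodType R.

Definition extends A B (f : {linear A -> B}) := forall Q, projective Q ->
  forall h : {linear A -> Q}, exists k : {linear B -> Q}, forall a, k (f a) = h a.

(* [Ext^1(X, Q) = 0] for all projective [Q]. *)
Definition ext_vanish X := forall A B (f : {linear A -> B}) (g : {linear B -> X}),
  ses f g -> extends f.

(** One projective presentation tests all extensions. Lifting [g] along [b] gives [l : P -> B],
    which restricts to [r : K -> A] and makes [B] the pushout of [A] and [P] over [K]. A map on [B]
    is thus a pair of maps on [A] and [P] agreeing on [K], and [h] is completed to such a pair by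
    extending [h \o r] along [f]. *)
Lemma ext_vanish_of_cover K P X (f : {linear K -> P}) (g : {linear P -> X}) :
  ses f g -> projective P -> extends f -> ext_vanish X.
Proof.
move=> fg pP fext A B a b ab Q pQ h.
have [fi gs gE] := fg; have [ai bs bE] := ab.
have [l lE] := pP _ _ b g bs.
have [r rE] : exists r : {linear K -> A}, forall k, a (r k) = l (f k).
  apply: (factor_inj (h := l \o f : {linear K -> B})) ai _ => k /=.
  by apply/bE; rewrite lE (ses_comp0 _ fg).
have [u uE] := fext Q pQ (h \o r : {linear K -> Q}).
have [s sE] := linear_copair a l; have [t tE] := linear_copair h u.
have [||k kE] := @factor_surj R _ _ _ s t.
- move=> y; have [p pE] := gs (b y).
  have /bE[x xE] : b (y - l p) = 0 by rewrite linearB lE pE subrr.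
  by exists (x, p); rewrite sE xE subrK.
- move=> [x p]; rewrite sE tE => e.
  have /gE[c cE] : g p = 0.
    by rewrite -lE -[l p](addKr (a x)) e addr0 linearN (ses_comp0 _ ab) oppr0.
  have -> : x = - r c.
    by apply: ai; rewrite linearN rE cE; apply/eqP; rewrite -addr_eq0 e.
  by rewrite linearN -cE uE addNr.
by exists k => x; have := kE (x, 0); rewrite sE tE !linear0 !addr0.
Qed.

(** Adding the complement [K] of [X] in [Y] turns an extension [B] of [X] by [A] into an extension
    [B * K] of [Y] by [A]; a map extended to [B * K] is restricted to [B]. *)
Lemma ext_vanish_retract X Y (i : {linear X -> Y}) (p : {linear Y -> X}) :
  (forall x, p (i x) = x) -> ext_vanish Y -> ext_vanish X.
Proof.
move=> pi evY A B a b ab Q pQ h; have [ai bs bE] := ab.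
have [K [j [ji jE]]] := kernel_exists p.
have [s sE] := linear_copair (i \o b : {linear B -> Y}) j.
have [t tE] := linear_inl B K.
have st : ses (t \o a : {linear A -> (B * K)%type}) s.
  split=> [||[x k]].
  - by move=> x y /=; rewrite !tE => -[/ai].
  - move=> y; have [x xE] := bs (p y).
    have /jE[k kE] : p (y - i (p y)) = 0 by rewrite linearB pi subrr.
    by exists (x, k); rewrite sE /= xE kE addrC subrK.
  - rewrite sE /=; split=> [e|[c]]; last first.
      by rewrite tE => -[<- <-]; rewrite (ses_comp0 _ ab) !linear0 addr0.
    have pj : p (j k) = 0 by apply/jE; exists k.
    have bx : b x = 0.
      by have := congr1 p e; rewrite linearD pi pj addr0 linear0.
    have [c cE] := (bE x).1 bx; exists c; rewrite tE cE; congr (_, _).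
    by apply/esym/(inj_eq0 ji); rewrite -e bx linear0 add0r.
have [k kE] := evY _ _ _ _ st Q pQ h.
by exists (k \o t : {linear B -> Q}).
Qed.

(** For an extension [B'] of [B] by [A'], the preimage [K] of [A] in [B'] is an extension of [A] by
    [A'], and [B'] is an extension of [C] by [K]. The map is extended first to [K], then to [B']. *)
Lemma ext_vanish_ext A B C (f : {linear A -> B}) (g : {linear B -> C}) :
  ses f g -> ext_vanish A -> ext_vanish C -> ext_vanish B.
Proof.
move=> fg evA evC A' B' a b ab Q pQ h; have [fi gs gE] := fg; have [ai bs bE] := ab.
have [K [j [ji jE]]] := kernel_exists (g \o b : {linear B' -> C}).
have jgb : ses j (g \o b : {linear B' -> C}).
  by split=> // y; have [x <-] := gs y; have [z <-] := bs x; exists z.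
have [r rE] : exists r : {linear A' -> K}, forall x, j (r x) = a x.
  by apply: factor_inj => // x; apply/jE; rewrite /= (ses_comp0 _ ab) linear0.
have [s sE] : exists s : {linear K -> A}, forall x, f (s x) = b (j x).
  apply: (factor_inj (h := b \o j : {linear K -> B})) fi _ => x /=.
  by apply/gE; apply: (ses_comp0 _ jgb).
have rs : ses r s.
  split=> [|x|x].
  - by apply: inj0 => x e; apply: (inj_eq0 ai); rewrite -rE e linear0.
  - have [z zE] := bs (f x).
    have /jE[k kE] : (g \o b) z = 0 by rewrite /= zE (ses_comp0 _ fg).
    by exists k; apply: fi; rewrite sE kE zE.
  - split=> [e|[c <-]].
      have /bE[c cE] : b (j x) = 0 by rewrite -sE e linear0.
      by exists c; apply: ji; rewrite rE.
    by apply: (inj_eq0 fi); rewrite sE rE (ses_comp0 _ ab).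
have [k kE] := evA _ _ _ _ rs Q pQ h.
have [l lE] := evC _ _ _ _ jgb Q pQ k.
by exists l => x; rewrite -rE lE kE.
Qed.

Lemma retract_complement X G (i : {linear X -> G}) (p : {linear G -> X}) :
  (forall x, p (i x) = x) ->
  exists K (j : {linear K -> G}) (r : {linear G -> K}),
    [/\ injective j, forall z, p z = 0 <-> exists k, j k = z,
        forall z, j (r z) = z - i (p z) & forall k, r (j k) = k].
Proof.
move=> pi; have [K [j [ji jE]]] := kernel_exists p.
have [|u uE] := @linear_exists R G G (fun z => z - i (p z)).
  by move=> c x y; rewrite !linearP scalerDr addrACA.
have [|r rE] := @factor_inj R _ _ _ j u ji.
  by move=> x; apply/jE; rewrite uE linearB pi subrr.
exists K, j, r; split=> // z; first by rewrite rE uE.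
apply: ji; rewrite rE uE (_ : p (j z) = 0) ?linear0 ?addr0 ?subr0 //.
by apply/jE; exists z.
Qed.

Definition right_step (S : lmodType R -> Prop) X :=
  exists P Y (f : {linear X -> P}) (g : {linear P -> Y}),
    [/\ projective P, S Y & ses f g].

Definition left_step (S : lmodType R -> Prop) X :=
  exists Z P (f : {linear Z -> P}) (g : {linear P -> X}),
    [/\ projective P, S Z & ses f g].

Definition gorenstein_class (S : lmodType R -> Prop) := forall X, S X ->
  [/\ ext_vanish X, right_step S X & left_step S X].

(** * The extension closure of the retracts of a Gorenstein class *)

Section Closure.
Variable S : lmodType R -> Prop.
Hypothesis gS : gorenstein_class S.

Inductive ext_closure : lmodType R -> Prop :=
| ext_closure_retract X G (i : {linear X -> G}) (p : {linear G -> X}) :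
    S G -> (forall x, p (i x) = x) -> ext_closure X
| ext_closure_ext A B C (f : {linear A -> B}) (g : {linear B -> C}) :
    ses f g -> ext_closure A -> ext_closure C -> ext_closure B.

Lemma ext_closure_base X : S X -> ext_closure X.
Proof. by move=> SX; apply: (@ext_closure_retract X X idfun idfun). Qed.

Lemma ext_closure_vanish X : ext_closure X -> ext_vanish X.
Proof.
elim=> [{}X G i p SG pi|A B C f g fg _ evA _ evC].
  by apply: (ext_vanish_retract pi); case: (gS SG).
exact: (ext_vanish_ext fg).
Qed.

(** For a retract [X] of [G], embed [X] in [P] through [G]. The cokernel [L] is an extension of [G']
    by the complement [K] of [X] in [G], and [K] is itself a retract of [G]. *)
Lemma ext_closure_right X : ext_closure X -> right_step ext_closure X.
Proof.
elim=> [{}X G i p SG pi|A B C a b ab _ rA cC rC].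
  have [_ [P [G' [f [g [pP SG' fg]]]]] _] := gS SG; have [fi gs gE] := fg.
  have ii : injective i by move=> x y /(congr1 p); rewrite !pi.
  have [L [q [qs qE]]] := cokernel_exists (f \o i : {linear X -> P}).
  have [K [j [pi' [ji jE piE pi'j]]]] := retract_complement pi.
  have pj k : p (j k) = 0 by apply/jE; exists k.
  exists P, L, (f \o i : {linear X -> P}), q; split=> //; last first.
    by split=> // x y /= /fi/ii.
  have [|t tE] := @factor_surj R _ _ _ q g qs.
    by move=> x /qE[c <-] /=; rewrite (ses_comp0 _ fg).
  apply: (@ext_closure_ext K L G' (q \o (f \o j) : {linear K -> L}) t);
    last exact: ext_closure_base.
    split=> [|y|y].
    - apply: inj0 => k /= /qE[c /= /fi e].
      have c0 : c = 0 by rewrite -(pi c) e pj.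
      by apply: (inj_eq0 ji); rewrite -e c0 linear0.
    - by have [x <-] := gs y; exists (q x).
    - split=> [|[k <-]] /=; last by rewrite tE (ses_comp0 _ fg).
      have [x <-] := qs y; rewrite tE => /gE[z <-].
      exists (pi' z); rewrite piE linearB linearB.
      suff -> : q (f (i (p z))) = 0 by rewrite subr0.
      by apply/qE; exists (p z).
  exact: (@ext_closure_retract K G j pi').
have [P [A' [s [t [pP cA' st]]]]] := rA; have [si ts tE] := st.
have [P' [C' [s' [t' [pP' cC' st']]]]] := rC; have [si' ts' tE'] := st'.
have [ai bs bE] := ab.
(* Horseshoe argument for an extension: [Ext^1(C, P) = 0] extends [A -> P] to [B], so [B] embeds in
   [P * P'], with cokernel an extension of [C'] by [A']. *)
have [u uE] := ext_closure_vanish cC ab pP s.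
have [v vE] := linear_pair u (s' \o b : {linear B -> P'}).
have [B' [q [qs qE]]] := cokernel_exists v.
exists (P * P')%type, B', v, q; split; [exact: projective_prod| |]; last first.
  split=> //; apply: inj0 => x; rewrite vE => -[ux /= sx].
  have /bE[c cE] : b x = 0 by exact: inj_eq0 sx.
  by rewrite -cE (inj_eq0 si (x := c)) ?linear0 // -uE cE.
have [inP inPE] := linear_inl P P'.
have [sndP sndPE] := linear_snd P P'.
have [|m mE] := @factor_surj R _ _ _ t (q \o inP : {linear P -> B'}) ts.
  move=> x /tE[c <-] /=; apply/qE; exists (a c).
  by rewrite vE uE /= (ses_comp0 _ ab) linear0 inPE.
have [|n nE] := @factor_surj R _ _ _ q (t' \o sndP : {linear (P * P')%type -> C'}) qs.
  by move=> x /qE[c <-] /=; rewrite vE sndPE /= (ses_comp0 _ st').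
apply: (@ext_closure_ext A' B' C' m n) => //; split=> [|y|y].
- apply: inj0 => x; have [w <-] := ts x; rewrite mE /= => /qE[c].
  rewrite vE inPE => -[uc /= /(inj_eq0 si') /bE[d dE]].
  by apply/tE; exists d; rewrite -uE dE.
- have [x <-] := ts' y; exists (q (0, x)).
  by rewrite nE /= sndPE.
- have [[x x'] <-] := qs y; rewrite nE /= sndPE; split=> [|[z]].
    move=> /tE'[c cE]; have [d dE] := bs c.
    (* Subtracting [v d] from [(x, x')] kills the second coordinate without changing the class in
       [B']. *)
    exists (t (x - u d)); rewrite mE /=; apply/eqP; rewrite -subr_eq0 -linearB.
    apply/eqP/qE; exists (- d); rewrite linearN vE inPE /= dE cE.
    by congr (_, _); rewrite /= ?sub0r // addrAC subrr sub0r.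
  have [w <-] := ts z; rewrite mE /= => /eqP; rewrite -subr_eq0 -linearB.
  move=> /eqP/qE[c]; rewrite vE inPE => -[_ /= e].
  by rewrite -[x']opprK -[- x']add0r -e linearN (ses_comp0 _ st') oppr0.
Qed.

(** For a retract [X] of [G], cover [X] by [P] through [G]. The kernel [L] is an extension of the
    complement [K] by the syzygy [G'] of [G]. *)
Lemma ext_closure_left X : ext_closure X -> left_step ext_closure X.
Proof.
elim=> [{}X G i p SG pi|A B C a b ab _ lA _ lC].
  have [_ _ [G' [P [f [g [pP SG' fg]]]]]] := gS SG; have [fi gs gE] := fg.
  have [L [k [ki kE]]] := kernel_exists (p \o g : {linear P -> X}).
  have [K [j [pi' [ji jE piE pi'j]]]] := retract_complement pi.
  have pj x : p (j x) = 0 by apply/jE; exists x.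
  exists L, P, k, (p \o g : {linear P -> X}); split=> //; last first.
    by split=> // y; have [x xE] := gs (i y); exists x; rewrite /= xE pi.
  have [|m mE] := @factor_inj R _ _ _ k f ki.
    by move=> x; apply/kE; rewrite /= (ses_comp0 _ fg) linear0.
  have [|n nE] := @factor_inj R _ _ _ j (g \o k : {linear L -> G}) ji.
    by move=> x; apply/jE; apply/(kE (k x)); exists x.
  apply: (@ext_closure_ext G' L K m n); first split=> [|y|y].
  - by move=> x y e; apply: fi; rewrite -!mE e.
  - have [x xE] := gs (j y).
    have /kE[l lE] : (p \o g) x = 0 by rewrite /= xE pj.
    by exists l; apply: ji; rewrite nE /= lE.
  - split=> [e|[c <-]].
      have /gE[c cE] : g (k y) = 0 by have := nE y; rewrite e linear0.
      by exists c; apply: ki; rewrite mE.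
    by apply: (inj_eq0 ji); rewrite nE /= mE (ses_comp0 _ fg).
  - exact: ext_closure_base.
  - exact: (@ext_closure_retract K G j pi').
have [A' [P [s [t [pP cA' st]]]]] := lA; have [si ts tE] := st.
have [C' [P' [s' [t' [pP' cC' st']]]]] := lC; have [si' ts' tE'] := st'.
have [ai bs bE] := ab.
(* Horseshoe argument for an extension: lifting [P' -> C] to [B] gives a cover of [B] by [P * P'],
   whose kernel is an extension of [C'] by [A']. *)
have [l lE] := pP' _ _ b t' bs.
have [v vE] := linear_copair (a \o t : {linear P -> B}) l.
have bv x y : b (v (x, y)) = t' y.
  by rewrite vE linearD lE (ses_comp0 _ ab) add0r.
have [B' [k [ki kE]]] := kernel_exists v.
exists B', (P * P')%type, k, v; split; [exact: projective_prod| |]; last first.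
  split=> // y; have [x xE] := ts' (b y).
  have /bE[z zE] : b (y - l x) = 0 by rewrite linearB lE xE subrr.
  have [w wE] := ts z; exists (w, x).
  by rewrite vE /= wE zE subrK.
have [inP inPE] := linear_inl P P'.
have [sndP sndPE] := linear_snd P P'.
have [|m mE] := @factor_inj R _ _ _ k (inP \o s : {linear A' -> (P * P')%type}) ki.
  by move=> x; apply/kE; rewrite /= inPE vE /= (ses_comp0 _ st) !linear0 addr0.
have [|n nE] := @factor_inj R _ _ _ s' (sndP \o k : {linear B' -> P'}) si'.
  move=> x; apply/tE' => /=; case e: (k x) => [y z].
  by rewrite sndPE -(bv y) -e (kE (k x)).2 ?linear0 //; exists x.
apply: (@ext_closure_ext A' B' C' m n) => //; split=> [|y|y].
- by apply: inj0 => x e; have := mE x; rewrite e linear0 /= inPE => -[/esym/(inj_eq0 si)].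
- have /bE[z zE] : b (l (s' y)) = 0 by rewrite lE (ses_comp0 _ st').
  have [w wE] := ts z.
  have /kE[x xE] : v (- w, s' y) = 0 by rewrite vE /= linearN wE linearN zE addNr.
  by exists x; apply: si'; rewrite nE /= xE sndPE.
- split=> [e|[c <-]]; last first.
    by apply: (inj_eq0 si'); rewrite nE /= mE /= inPE sndPE.
  case kyE: (k y) => [x z]; have := nE y; rewrite e linear0 /= kyE sndPE => z0.
  have : v (x, z) = 0 by apply/kE; exists y.
  rewrite vE -z0 linear0 addr0 /= => /(inj_eq0 ai)/tE[c cE].
  by exists c; apply: ki; rewrite mE /= inPE cE kyE z0.
Qed.

Lemma ext_closure_class : gorenstein_class ext_closure.
Proof.
move=> X cX; split.
- exact: ext_closure_vanish.
- exact: ext_closure_right.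
- exact: ext_closure_left.
Qed.

End Closure.

End Extensions.

(** * Gorenstein projective modules: splicing, closure properties, dimension *)

Section GorensteinClass.
Variable R : comPzRingType.
Implicit Types G K M N X Y Z P Q : lmodType R.

(** Modules isomorphic to a cycle module of the complex. By exactness these are the images of the
    differentials; the kernel form avoids naming a predecessor of [i]. *)
Let image_class (C : int -> lmodType R) (d : forall i, {linear C i -> C (i + 1)}) X :=
  exists i (f : {linear X -> C i}),
    injective f /\ forall y, d i y = 0 <-> exists x, f x = y.

Let image_class_gorenstein (C : int -> lmodType R)
    (d : forall i, {linear C i -> C (i + 1)}) :
  exact_Z d -> (forall i, projective (C i)) ->
  (forall Q, projective Q -> Hom_exact_Z d Q) -> gorenstein_class (image_class d).
Proof.
move=> dex pC dQ X [i [f [fi fE]]].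
have shift (j : int) : exists k, j = k + 1 by exists (j - 1); rewrite subrK.
have [K [k [ki kE]]] := kernel_exists (d i).
have [K' [k' [ki' kE']]] := kernel_exists (d (i + 1)).
split.
(* [i] is written as a threefold successor: [X] is covered by [C (j + 1 + 1)] with kernel [L], and
   [Hom_exact_Z] at [j] extends the composite [C (j + 1) -> L -> Q]. *)
- have [j ij] := shift i; have [j' jj] := shift j; subst j.
  have [j jj] := shift j'; subst j' i.
  have [L [l [li lE]]] := kernel_exists (d (j + 1 + 1)).
  have [|s sE] := @factor_inj R _ _ _ f (d (j + 1 + 1)) fi.
    by move=> x; apply/fE/dex; exists x.
  have ls : ses l s.
    split=> // y.
      have /fE/dex[z zE] : exists x, f x = f y by exists y.
      by exists z; apply: fi; rewrite sE.
    split=> [e|]; first by apply/lE; rewrite -sE e linear0.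
    by move=> /lE e; apply: (inj_eq0 fi); rewrite sE.
  apply: (ext_vanish_of_cover ls) => // Q pQ h.
  have [|t tE] := @factor_inj R _ _ _ l (d (j + 1)) li.
    by move=> x; apply/lE/dex; exists x.
  have [|g gE] := dQ Q pQ j (h \o t : {linear C (j + 1) -> Q}).
    move=> y /=; suff -> : t (d j y) = 0 by rewrite linear0.
    by apply: (inj_eq0 li); rewrite tE; apply/dex; exists y.
  exists g => x; have /lE/dex[y yE] : exists z, l z = l x by exists x.
  rewrite -yE -gE /=; congr (h _); apply: li.
  by rewrite tE.
- have [|s sE] := @factor_inj R _ _ _ k' (d i) ki'.
    by move=> x; apply/kE'/dex; exists x.
  exists (C i), K', f, s; split=> //; first by exists (i + 1), k'.
  split=> // y.
    have /kE'/dex[z zE] : exists x, k' x = k' y by exists y.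
    by exists z; apply: ki'; rewrite sE.
  split=> [e|]; first by apply/fE; rewrite -sE e linear0.
  by move=> /fE e; apply: (inj_eq0 ki'); rewrite sE.
- have [j ij] := shift i; subst i.
  have [L [l [li lE]]] := kernel_exists (d j).
  have [|s sE] := @factor_inj R _ _ _ f (d j) fi.
    by move=> x; apply/fE/dex; exists x.
  exists L, (C j), l, s; split=> //; first by exists j, l.
  split=> // y.
    have /fE/dex[z zE] : exists x, f x = f y by exists y.
    by exists z; apply: fi; rewrite sE.
  split=> [e|]; first by apply/lE; rewrite -sE e linear0.
  by move=> /lE e; apply: (inj_eq0 fi); rewrite sE.
Qed.

(** Steps to the right and to the left of [M] stay in [S], so they can be iterated and spliced into
    a complex indexed by the integers, whose cycle modules are members of [S]. *)
Lemma gorenstein_projective_of_class (S : lmodType R -> Prop) M :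
  gorenstein_class S -> S M -> gorenstein_projective M.
Proof.
move=> gS SM.
pose joined X Y := exists P (f : {linear X -> P}) (g : {linear P -> Y}),
  projective P /\ ses f g.
have [next nextE] : exists next : {X | S X} -> {X | S X},
    forall E, joined (sval E) (sval (next E)).
  apply: (dependent_choice_fun (P := fun E F => joined (sval E) (sval F))).
  case=> X SX; have [_ [P [Y [f [g [pP SY fg]]]]] _] := gS _ SX.
  by exists (exist _ Y SY), P, f, g.
have [prev prevE] : exists prev : {X | S X} -> {X | S X},
    forall E, joined (sval (prev E)) (sval E).
  apply: (dependent_choice_fun (P := fun E F => joined (sval F) (sval E))).
  case=> X SX; have [_ _ [Z [P [f [g [pP SZ fg]]]]]] := gS _ SX.
  by exists (exist _ Z SZ), P, f, g.
(* [M] is placed in degree [1 = 0 + 1], where [gorenstein_projective] expects it. *)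
pose M1 : {X | S X} := exist _ M SM.
(* [Negz n] is [-n-1], which lies [n+2] steps to the left of degree 1. *)
pose E (i : int) : {X | S X} := match i with
  | Posz 0 => prev M1 | Posz n.+1 => iter n next M1
  | Negz n => iter n.+2 prev M1 end.
pose X i := sval (E i).
have XE i : joined (X i) (X (i + 1)).
  case: i => [[|n]|[|n]].
  - exact: prevE.
  - by rewrite -PoszD addn1; apply: nextE.
  - by rewrite NegzE addNr; apply: prevE.
  - rewrite (_ : Negz n.+1 + 1 = Negz n); first exact: prevE.
    by rewrite !NegzE -(addn1 n.+1) PoszD opprD addrNK.
have [P XE1] := dependent_choice_fun XE.
have [f XE2] := dependent_choice_fun XE1.
have [g XE3] := dependent_choice_fun XE2.
have fg i : ses (f i) (g i) by case: (XE3 i).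
pose d i : {linear P i -> P (i + 1)} := f (i + 1) \o g i.
exists P, d; split.
- move=> i x; have [fi gs gE] := fg i; have [fi' gs' gE'] := fg (i + 1).
  have [fi2 _ _] := fg (i + 1 + 1).
  rewrite /d /=; split=> [/(inj_eq0 fi2)/gE'[y <-]|[y <-]].
    by have [z <-] := gs y; exists z.
  by rewrite (ses_comp0 _ (fg (i + 1))) linear0.
- by move=> i; case: (XE3 i).
- move=> Q pQ i h hd; have [fi gs gE] := fg i; have [fi' gs' gE'] := fg (i + 1).
  (* [h] factors through the cycle module [X (i + 1 + 1)], and the factor [k] extends to
     [P (i + 1 + 1)] because the next cycle module has vanishing [Ext^1]. *)
  have [|k kE] := @factor_surj R _ _ _ (g (i + 1)) h gs'.
    by move=> x /gE'[y <-]; have [z <-] := gs y; apply: hd.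
  have SX j : S (X j) by exact: (proj2_sig (E j)).
  have [ev _ _] := gS _ (SX (i + 1 + 1 + 1)).
  have [l lE] := ev _ _ _ _ (fg (i + 1 + 1)) Q pQ k.
  by exists l => x; rewrite /d /= lE kE.
- exists (f (0 + 1)); split; first by case: (fg (0 + 1)).
  have [_ gs _] := fg 0; move=> y; rewrite /d; split=> -[x <-].
    by have [z <-] := gs x; exists z.
  by exists (g 0 x).
Qed.

Lemma gorenstein_projective_class : gorenstein_class (@gorenstein_projective R).
Proof.
move=> M [C [d [dex pC dQ [phi [phi_inj phiE]]]]].
have gS := image_class_gorenstein dex pC dQ.
have [|ev [P [Y [f [g [pP SY fg]]]]] [Z [P' [f' [g' [pP' SZ fg']]]]]] := gS M.
  exists (0 + 1), phi; split=> // y; split; first by move=> /dex/phiE.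
  by move=> /phiE/dex.
split=> //.
  by exists P, Y, f, g; split=> //; apply: gorenstein_projective_of_class gS SY.
by exists Z, P', f', g'; split=> //; apply: gorenstein_projective_of_class gS SZ.
Qed.

Lemma projective_ext_vanish X : projective X -> ext_vanish X.
Proof.
move=> pX A B a b ab Q _ h; have [ai bs bE] := ab.
have [s sE] := pX _ _ b idfun bs.
have [|u uE] := @linear_exists R B B (fun y => y - s (b y)).
  by move=> c x y; rewrite !linearP scalerDr addrACA.
have [|r rE] := @factor_inj R _ _ _ a u ai.
  by move=> x; apply/bE; rewrite uE linearB sE subrr.
exists (h \o r : {linear B -> Q}) => x /=; congr (h _); apply: ai.
by rewrite rE uE (ses_comp0 _ ab) linear0 subr0.
Qed.

(** The projectives form a Gorenstein class: the identity of [X] gives both steps, with third term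
    zero. *)
Lemma projective_gorenstein X : projective X -> gorenstein_projective X.
Proof.
apply: gorenstein_projective_of_class => {}X pX.
pose O : lmodType R := 'rV[R]_0.
have O0 (x : O) : x = 0 by apply/rowP; case.
have pO : projective O.
  by move=> N N' g f gs; exists \0 => x; rewrite (O0 x) !linear0.
split; first exact: projective_ext_vanish.
- exists X, O, idfun, \0; split=> //; split=> //.
  + by move=> y; exists 0; rewrite (O0 y).
  + by move=> b; split=> // _; exists b.
- exists O, X, \0, idfun; split=> //; split=> //.
  + by move=> x y _; rewrite (O0 x) (O0 y).
  + by move=> y; exists y.
  + by move=> b; split=> /= [->|[_ <-]] //; exists 0.
Qed.

Lemma gorenstein_projective_retract X G (i : {linear X -> G}) (p : {linear G -> X}) :
  gorenstein_projective G -> (forall x, p (i x) = x) -> gorenstein_projective X.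
Proof.
move=> gG pi; apply: gorenstein_projective_of_class.
  exact: (ext_closure_class gorenstein_projective_class).
exact: ext_closure_retract pi.
Qed.

Lemma gorenstein_projective_ext X Y Z (f : {linear X -> Y}) (g : {linear Y -> Z}) :
  ses f g -> gorenstein_projective X -> gorenstein_projective Z ->
  gorenstein_projective Y.
Proof.
move=> fg gX gZ; apply: gorenstein_projective_of_class.
  exact: (ext_closure_class gorenstein_projective_class).
by apply: (ext_closure_ext fg); apply: ext_closure_base.
Qed.

Lemma gorenstein_projective_prod X Y : gorenstein_projective X ->
  gorenstein_projective Y -> gorenstein_projective (X * Y)%type.
Proof. by have [i [p ip]] := ses_split_inl X Y; apply: gorenstein_projective_ext ip. Qed.

(** Embed [X] in a projective [P] with cokernel [X']. Since [X -> P] extends to [Y], the pushout of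
    [P] and [Y] over [X] is [P * Z]; it is an extension of [X'] by [Y], and [Z] is a summand of
    it. *)
Lemma gorenstein_projective_coker X Y Z (f : {linear X -> Y}) (g : {linear Y -> Z}) :
  ses f g -> extends f -> gorenstein_projective X -> gorenstein_projective Y ->
  gorenstein_projective Z.
Proof.
move=> fg fext gX gY; have [fi gs gE] := fg.
have [_ [P [X' [s [t [pP gX' st]]]]] _] := gorenstein_projective_class gX.
have [si ts tE] := st.
have [k kE] := fext P pP s.
have [u uE] := linear_pair k g.
have [|m mE] := @linear_exists R (P * Y)%type (P * Z)%type (fun x => (x.1, g x.2)).
  by move=> c [x y] [x' y']; congr (_, _); rewrite /= !linearP.
have [|n nE] := @linear_exists R (P * Y)%type X' (fun x => t (x.1 - k x.2)).
  by move=> c [x y] [x' y'] /=; rewrite !linearP addrACA -scalerDr linearP.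
have [||v vE] := @factor_surj R _ _ _ m n.
- by move=> [p z]; have [y <-] := gs z; exists (p, y); rewrite mE.
- move=> [p y]; rewrite mE nE /= => -[-> /gE[x <-]].
  by rewrite sub0r kE linearN (ses_comp0 _ st) oppr0.
have uv : ses u v.
  split.
  - apply: inj0 => y; rewrite uE => -[ky /gE[x xE]].
    by rewrite -xE (inj_eq0 si (x := x)) ?linear0 // -kE xE.
  - move=> y; have [p <-] := ts y; exists (m (p, 0)).
    by rewrite vE nE /= linear0 subr0.
  - move=> [p z]; have [y <-] := gs z.
    have -> : (p, g y) = m (p, y) by rewrite mE.
    rewrite vE nE /=; split=> [/tE[x xE]|[y']].
      exists (f x + y); rewrite uE !linearD kE (ses_comp0 _ fg) add0r xE subrK.
      by rewrite mE.
    rewrite uE mE => -[<- e]; apply/tE.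
    have /gE[x xE] : g (y' - y) = 0 by rewrite linearB e subrr.
    by exists x; rewrite -kE xE linearB.
have [inr inrE] := linear_inr P Z; have [snd sndE] := linear_snd P Z.
apply: (@gorenstein_projective_retract Z (P * Z)%type inr snd).
  exact: (gorenstein_projective_ext uv).
by move=> z; rewrite inrE sndE.
Qed.

(* The pullback of [G -> N <- P] is split over [P], hence is [K * P], and its
   projection to [G] has kernel [N1]. *)
Lemma pullback_ses K G N (N1 : lmodType R) P (f : {linear K -> G}) (g : {linear G -> N})
    (s : {linear N1 -> P}) (t : {linear P -> N}) :
  projective P -> ses f g -> ses s t ->
  exists (u : {linear N1 -> (K * P)%type}) (v : {linear (K * P)%type -> G}), ses u v.
Proof.
move=> pP fg st; have [fi gs gE] := fg; have [si ts tE] := st.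
have [l lE] := pP _ _ g t gs.
have [v vE] := linear_copair f l.
have [|r rE] := @factor_inj R _ _ _ f (l \o s : {linear N1 -> G}) fi.
  by move=> x; apply/gE; rewrite /= lE (ses_comp0 _ st).
(* The sign makes [v] vanish on the image of [u], as [f (r x) = l (s x)]. *)
have [u uE] := linear_pair (\- r : {linear N1 -> K}) s.
exists u, v; split.
- by move=> x y; rewrite !uE => -[_ /si].
- move=> y; have [p pE] := ts (g y).
  have /gE[k kE] : g (y - l p) = 0 by rewrite linearB lE pE subrr.
  by exists (k, p); rewrite vE kE subrK.
- move=> [k p]; rewrite vE; split=> [e|[x]]; last first.
    by rewrite uE => -[<- <-] /=; rewrite linearN rE addNr.
  have /tE[x xE] : t p = 0.
    by rewrite -lE -[l p](addKr (f k)) e addr0 linearN (ses_comp0 _ fg) oppr0.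
  exists x; rewrite uE xE; congr (_, _) => /=.
  by apply: fi; rewrite linearN rE /= xE; apply/eqP; rewrite eq_sym -addr_eq0 e.
Qed.

(** Comparison with a projective cover of [N] whose kernel [N1] is Gorenstein projective exhibits
    [K * P] as an extension of [G] by [N1]; [K] is a summand of it. *)
Lemma gorenstein_projective_ker K G N (f : {linear K -> G}) (g : {linear G -> N}) :
  ses f g -> gorenstein_projective G -> gorenstein_projective N ->
  gorenstein_projective K.
Proof.
move=> fg gG gN.
have [_ _ [N1 [P [s [t [pP gN1 st]]]]]] := gorenstein_projective_class gN.
have [u [v uv]] := pullback_ses pP fg st.
have [inl inlE] := linear_inl K P; have [fst fstE] := linear_fst K P.
apply: (@gorenstein_projective_retract K (K * P)%type inl fst).
  exact: (gorenstein_projective_ext uv).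
by move=> z; rewrite inlE fstE.
Qed.

(** The bound [Gpd_le] unrolled into one short exact sequence per degree, the form suited to
    induction on [n]. *)
Fixpoint gpd_le n N : Prop :=
  if n is m.+1 then
    exists K G (f : {linear K -> G}) (g : {linear G -> N}),
      [/\ gorenstein_projective G, gpd_le m K & ses f g]
  else gorenstein_projective N.

Lemma gpd_le_prod n X P : projective P -> gpd_le n X -> gpd_le n (X * P)%type.
Proof.
move=> pP; case: n => [|n] /=.
  by move=> gX; apply: gorenstein_projective_prod => //; apply: projective_gorenstein.
move=> [K [G [f [g [gG gK fg]]]]]; have [fi gs gE] := fg.
have [i iE] := linear_inl G P.
have [|h hE] := @linear_exists R (G * P)%type (X * P)%type (fun x => (g x.1, x.2)).
  by move=> c [x y] [x' y']; congr (_, _); rewrite /= linearP.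
exists K, (G * P)%type, (i \o f : {linear K -> (G * P)%type}), h; split=> //.
  by apply: gorenstein_projective_prod => //; apply: projective_gorenstein.
split=> [x y /=|[x p]|[x p]].
- by rewrite !iE => -[/fi].
- by have [y <-] := gs x; exists (y, p); rewrite hE.
- rewrite hE /=; split=> [[/gE[k <-] ->]|[k]]; first by exists k; rewrite iE.
  by rewrite iE => -[<- <-]; rewrite (ses_comp0 _ fg).
Qed.

(** If [G'] covers [X] with kernel [K'], the preimage [L] of [K] in [G'] covers [K] with the same
    kernel; [L] is Gorenstein projective as the kernel of [G' -> G]. *)
Lemma gpd_le_ker n K X G (f : {linear K -> X}) (g : {linear X -> G}) :
  ses f g -> gpd_le n X -> gorenstein_projective G -> gpd_le n K.
Proof.
case: n => [|n] /=; first by move=> fg gX gG; apply: gorenstein_projective_ker fg gX gG.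
move=> fg [K' [G' [s [t [gG' gK' st]]]]] gG.
have [fi gs gE] := fg; have [si ts tE] := st.
have [L [l [li lE]]] := kernel_exists (g \o t : {linear G' -> G}).
have lgt : ses l (g \o t : {linear G' -> G}).
  by split=> // y; have [x <-] := gs y; have [z <-] := ts x; exists z.
have [|m mE] := @factor_inj R _ _ _ l s li.
  by move=> x; apply/lE; rewrite /= (ses_comp0 _ st) linear0.
have [|n' nE] := @factor_inj R _ _ _ f (t \o l : {linear L -> X}) fi.
  by move=> x; apply/gE; apply: (ses_comp0 _ lgt).
exists K', L, m, n'; split=> //; first exact: gorenstein_projective_ker lgt gG' gG.
split=> [x y e|y|y].
- by apply: si; rewrite -!mE e.
- have [x xE] := ts (f y).
  have /lE[z zE] : (g \o t) x = 0 by rewrite /= xE (ses_comp0 _ fg).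
  by exists z; apply: fi; rewrite nE /= zE.
- split=> [e|[c <-]].
    have /tE[c cE] : t (l y) = 0 by have := nE y; rewrite e linear0.
    by exists c; apply: li; rewrite mE.
  by apply: (inj_eq0 fi); rewrite nE /= mE (ses_comp0 _ st).
Qed.

(** Schanuel's argument: any projective presentation lowers the bound, since [N1] is the kernel of a
    surjection from [K * P] onto [G]. *)
Lemma gpd_le_syzygy n (N1 : lmodType R) P N (s : {linear N1 -> P}) (t : {linear P -> N}) :
  ses s t -> projective P -> gpd_le n.+1 N -> gpd_le n N1.
Proof.
move=> st pP [K [G [f [g [gG gK fg]]]]].
have [u [v uv]] := pullback_ses pP fg st.
by apply: (gpd_le_ker uv) => //; apply: gpd_le_prod.
Qed.

(** In length 0 the augmentation is bijective because [G 1] vanishes. Otherwise the shifted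
    resolution resolves the kernel of the augmentation. *)
Lemma Gpd_le_gpd_le n N : Gpd_le N n -> gpd_le n N.
Proof.
elim: n N => [|n IH] N [G [e [eps [gG G0 eps_s eps_e ex]]]].
  have eps_i : injective eps.
    by apply: inj0 => x /eps_e[y <-]; rewrite (G0 1%N _ y) // linear0.
  have [|k kE] := @factor_inj R _ _ _ eps idfun eps_i.
    by move=> x; have [y <-] := eps_s x; exists y.
  exact: (@gorenstein_projective_retract N (G 0) k eps).
have [K [k [ki kE]]] := kernel_exists eps.
exists K, (G 0), k, eps; split=> //.
apply: IH; have [|h hE] := @factor_inj R _ _ _ k (e 0%N) ki.
  by move=> x; apply/kE/eps_e; exists x.
exists (fun i => G i.+1), (fun i => e i.+1), h; split=> //.
- by move=> i ni; apply: G0.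
- move=> y; have /kE/eps_e[x xE] : exists z, k z = k y by exists y.
  by exists x; apply: ki; rewrite hE.
- move=> x; rewrite -ex -hE; split=> [->|]; first by rewrite linear0.
  exact: inj_eq0.
Qed.

End GorensteinClass.

(** * Free modules, and maps from finitely generated modules to projectives *)

Section FreeModules.
Variable R : comPzRingType.
Implicit Types A B M N Q : lmodType R.

Lemma linear_coord m (j : 'I_m) :
  exists h : {linear 'rV[R]_m -> R^o}, forall v, h v = v 0 j.
Proof. by apply: linear_exists => c u v; rewrite !mxE. Qed.

Lemma linear_row m N (h : 'I_m -> {linear N -> R^o}) :
  exists k : {linear N -> 'rV[R]_m}, forall y j, k y 0 j = h j y.
Proof.
have [|k kE] := @linear_exists R N 'rV[R]_m (fun y => \row_j h j y).
  by move=> c x y; apply/rowP => j; rewrite !mxE linearP.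
by exists k => y j; rewrite kE mxE.
Qed.

Lemma linear_row_comb m N (x : 'I_m -> N) :
  exists h : {linear 'rV[R]_m -> N}, forall v, h v = \sum_j v 0 j *: x j.
Proof.
apply: linear_exists => c u v; rewrite scaler_sumr -big_split.
by apply: eq_bigr => j _; rewrite !mxE scalerDl scalerA.
Qed.

Lemma row_free_ext m N (f g : {linear 'rV[R]_m -> N}) :
  (forall j, f (delta_mx 0 j) = g (delta_mx 0 j)) -> forall v, f v = g v.
Proof.
move=> fg v; rewrite (row_sum_delta v) !linear_sum.
by apply: eq_bigr => j _; rewrite !linearZ /= fg.
Qed.

Lemma row_comb_delta m N (x : 'I_m -> N) j :
  \sum_k (delta_mx 0 j : 'rV[R]_m) 0 k *: x k = x j.
Proof.
rewrite (bigD1 j) //= mxE !eqxx scale1r big1 ?addr0 // => k kj.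
by rewrite mxE (negPf kj) andbF scale0r.
Qed.

Lemma projective_row m : projective 'rV[R]_m.
Proof.
move=> N N' g f gs.
have [x xE] := dependent_choice_fun (fun j : 'I_m => gs (f (delta_mx 0 j))).
have [h hE] := linear_row_comb x; exists h.
apply: (@row_free_ext m N' (g \o h) f) => j.
by rewrite /= hE row_comb_delta xE.
Qed.

Lemma fin_gen_row m : fin_gen 'rV[R]_m.
Proof.
exists m, (fun j => delta_mx 0 j) => v; exists (fun j => v 0 j).
exact: row_sum_delta.
Qed.

Lemma fin_gen_surj A B (f : {linear A -> B}) : onto f -> fin_gen A -> fin_gen B.
Proof.
move=> fs [n [v vE]]; exists n, (fun i => f (v i)) => y.
have [x <-] := fs y; have [c {1}->] := vE x; exists c.
by rewrite linear_sum; apply: eq_bigr => i _; rewrite linearZ.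
Qed.

Lemma projective_retract A B (i : {linear A -> B}) (p : {linear B -> A}) :
  (forall x, p (i x) = x) -> projective B -> projective A.
Proof.
move=> pi pB N N' g f gs.
have [h hE] := pB _ _ g (f \o p : {linear B -> N'}) gs.
by exists (h \o i : {linear A -> N}) => x; rewrite /= hE /= pi.
Qed.

Section FiniteSupport.
Variable T : choiceType.
(** This cuts out the free module on [T]. Taking [T] to be the carrier of [Q] gives a free cover of
    an arbitrary [Q]. *)
Definition finsupp_pred : {pred T -> R^o} :=
  fun u => `[< exists s : seq T, forall x, x \notin s -> u x = 0 >].
Lemma finsupp_submod_closed : submod_closed finsupp_pred.
Proof.
split; first by apply/asboolP; exists [::].
move=> c u v /asboolP[s sE] /asboolP[t tE]; apply/asboolP; exists (s ++ t) => x.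
rewrite mem_cat negb_or => /andP[xs xt].
by rewrite /GRing.add /= /GRing.scale /= sE // tE // scaler0 addr0.
Qed.
HB.instance Definition _ :=
  GRing.isSubmodClosed.Build R (T -> R^o) finsupp_pred finsupp_submod_closed.
Record finsupp := FinSupp { finsupp_val : T -> R^o; _ : finsupp_val \in finsupp_pred }.
HB.instance Definition _ := [isSub for finsupp_val].
HB.instance Definition _ := [Choice of finsupp by <:].
HB.instance Definition _ := [SubChoice_isSubLmodule of finsupp by <:].

Lemma finsupp_supp (u : finsupp) :
  exists s : seq T, forall x, x \notin s -> finsupp_val u x = 0.
Proof. by case: u => u uP; apply/asboolP. Qed.

Lemma finsupp_valP c (u v : finsupp) x :
  finsupp_val (c *: u + v) x = c * finsupp_val u x + finsupp_val v x.
Proof. by []. Qed.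
End FiniteSupport.

(** The sum may run over any duplicate-free list containing the support. Two functions can then be
    summed over a common list, which yields linearity. *)
Lemma finsupp_comb Q : exists E : {linear finsupp Q -> Q}, forall u s,
  uniq s -> (forall x, x \notin s -> finsupp_val u x = 0) ->
  E u = \sum_(x <- s) finsupp_val u x *: x.
Proof.
pose E (u : finsupp Q) : Q := (\sum_(x \in [set: Q]) (finsupp_val u x *: x))%classic.
have EE u s : uniq s -> (forall x, x \notin s -> finsupp_val u x = 0) ->
    E u = \sum_(x <- s) finsupp_val u x *: x.
  move=> us sE; rewrite /E (@fsbigE _ _ _ _ _ s) //.
    by apply: eq_bigl => x; rewrite in_setT.
  by move=> x _ xs; rewrite sE // scale0r.
have [|h hE] := @linear_exists R (finsupp Q) Q E.
  move=> c u v; have [s sE] := finsupp_supp u; have [t tE] := finsupp_supp v.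
  rewrite !(EE _ (undup (s ++ t))) ?undup_uniq //.
  - rewrite scaler_sumr -big_split; apply: eq_bigr => x _.
    by rewrite finsupp_valP scalerDl scalerA.
  - by move=> x; rewrite mem_undup mem_cat negb_or => /andP[_ /tE].
  - by move=> x; rewrite mem_undup mem_cat negb_or => /andP[/sE].
  - move=> x; rewrite mem_undup mem_cat negb_or => /andP[/sE e /tE e'].
    by rewrite finsupp_valP e e' mulr0 addr0.
by exists h => u s us sE; rewrite hE (EE _ s).
Qed.

Lemma finsupp_comb_surj Q (E : {linear finsupp Q -> Q}) :
  (forall u s, uniq s -> (forall x, x \notin s -> finsupp_val u x = 0) ->
     E u = \sum_(x <- s) finsupp_val u x *: x) -> onto E.
Proof.
move=> EE y; have dP : (fun x => if x == y then 1 else 0 : R^o) \in @finsupp_pred Q.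
  by apply/asboolP; exists [:: y] => x; rewrite inE => /negPf->.
exists (FinSupp dP); rewrite (EE _ [:: y]) //.
  by rewrite big_seq1 /= eqxx scale1r.
by move=> x; rewrite inE /= => /negPf->.
Qed.

(** A section [s] of the free cover of [Q] sends the images of the finitely many generators to
    functions supported in one finite list [r], so [s] after [f] lands in the free module on [r]. *)
Lemma fin_gen_factor A Q (f : {linear A -> Q}) : fin_gen A -> projective Q ->
  exists m (g : {linear A -> 'rV[R]_m}) (h : {linear 'rV[R]_m -> Q}),
    forall a, h (g a) = f a.
Proof.
move=> [n [v vE]] pQ; have [E EE] := finsupp_comb Q.
have [s sE] := pQ _ _ E idfun (finsupp_comb_surj EE).
have [t tE] := dependent_choice_fun (fun i => finsupp_supp (s (f (v i)))).
pose r := undup (flatten [seq t i | i <- enum 'I_n]).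
have rE a x : x \notin r -> finsupp_val (s (f a)) x = 0.
  move=> xr; have [ev evE] : exists ev : {linear finsupp Q -> R^o},
      forall u, ev u = finsupp_val u x by apply: linear_exists => c u w.
  have [c ->] := vE a; rewrite -evE !linear_sum big1 // => i _.
  rewrite !linearZ /= evE tE ?scaler0 //; apply: contra xr => xt.
  rewrite mem_undup; apply/flattenP; exists (t i) => //.
  by apply: map_f; rewrite mem_enum.
have [|g gE] := @linear_exists R A 'rV[R]_(size r)
    (fun a => \row_j finsupp_val (s (f a)) (nth 0 r j)).
  by move=> c a b; apply/rowP => j; rewrite !mxE !linearP.
have [h hE] := linear_row_comb (fun j : 'I_(size r) => nth 0 r j).
exists (size r), g, h => a; rewrite hE gE.
rewrite -[RHS]sE (EE _ r) ?undup_uniq //; last exact: rE.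
by rewrite (big_nth 0) big_mkord; apply: eq_bigr => j _; rewrite mxE.
Qed.

End FreeModules.

(** * Duals of finitely generated Gorenstein projective modules *)

Section Duality.
Variable R : comPzRingType.
Implicit Types A B C M N P Q X Y : lmodType R.

Lemma dual_ext M (u v : dual M) : (forall x, dual_val u x = dual_val v x) -> u = v.
Proof. by move=> uv; apply: val_inj; apply: funext. Qed.

Lemma dual_of_linear M (f : {linear M -> R^o}) :
  exists u : dual M, forall x, dual_val u x = f x.
Proof.
have lf : (f : M -> R^o) \in @linform_pred R M by apply/asboolP => c x y; rewrite linearP.
by exists (Dual lf).
Qed.

Lemma linear_of_dual M (u : dual M) :
  exists f : {linear M -> R^o}, forall x, f x = dual_val u x.
Proof. by apply: linear_exists; case: u => f fP; apply/asboolP. Qed.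

Lemma dual_valP M c (u v : dual M) x :
  dual_val (c *: u + v) x = c * dual_val u x + dual_val v x.
Proof. by []. Qed.

Lemma dual_eval M x : exists ev : {linear dual M -> R^o}, forall u, ev u = dual_val u x.
Proof. by apply: linear_exists. Qed.

Lemma dual_map A B (f : {linear A -> B}) : exists f' : {linear dual B -> dual A},
  forall u x, dual_val (f' u) x = dual_val u (f x).
Proof.
have H u : exists v : dual A, forall x, dual_val v x = dual_val u (f x).
  have [h hE] := linear_of_dual u.
  have [v vE] := dual_of_linear (h \o f : {linear A -> R^o}).
  by exists v => x; rewrite vE /= hE.
have [d dE] := dependent_choice_fun H.
have [|f' fE] := @linear_exists R (dual B) (dual A) d.
  by move=> c u v; apply: dual_ext => x; rewrite dual_valP !dE dual_valP.
by exists f' => u x; rewrite fE dE.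
Qed.

Lemma projective_ring : projective (R^o : lmodType R).
Proof.
have [c cE] := @linear_coord R 1 0.
have [|i iE] := @linear_exists R R^o 'rV[R]_1 (fun a => const_mx a).
  by move=> b x y; apply/rowP => j; rewrite !mxE.
apply: (@projective_retract R R^o 'rV[R]_1 i c); last exact: projective_row.
by move=> x; rewrite cE iE mxE.
Qed.

(** Left exactness of duality is formal; [f'] is onto by [extends f] at the projective module
    [R]. *)
Lemma dual_ses A B C (f : {linear A -> B}) (g : {linear B -> C})
    (g' : {linear dual C -> dual B}) (f' : {linear dual B -> dual A}) :
  ses f g -> extends f ->
  (forall u x, dual_val (f' u) x = dual_val u (f x)) ->
  (forall u x, dual_val (g' u) x = dual_val u (g x)) -> ses g' f'.
Proof.
move=> fg fext fE gE; have [fi gs gk] := fg; split.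
- move=> u v e; apply: dual_ext => y; have [x <-] := gs y.
  by rewrite -!gE e.
- move=> u; have [h hE] := linear_of_dual u.
  have [k kE] := fext _ projective_ring h.
  have [v vE] := dual_of_linear k; exists v; apply: dual_ext => x.
  by rewrite fE vE kE hE.
- move=> u; split=> [e|[v <-]]; last first.
    apply: dual_ext => x; rewrite fE gE (ses_comp0 _ fg).
    by have [h hE] := linear_of_dual v; rewrite -hE linear0.
  have [h hE] := linear_of_dual u.
  have [|k kE] := @factor_surj R _ _ _ g h gs.
    by move=> x /gk[y <-]; rewrite hE -fE e.
  have [v vE] := dual_of_linear k; exists v; apply: dual_ext => x.
  by rewrite gE vE kE hE.
Qed.

Lemma dual_row_basis m : exists b : 'I_m -> dual 'rV[R]_m,
  (forall j v, dual_val (b j) v = v 0 j) /\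
  forall u : dual 'rV[R]_m, u = \sum_j (dual_val u (delta_mx 0 j) : R) *: b j.
Proof.
have H (j : 'I_m) : exists u : dual 'rV[R]_m, forall v, dual_val u v = v 0 j.
  have [c cE] := @linear_coord R m j; have [u uE] := dual_of_linear c.
  by exists u => v; rewrite uE cE.
have [b bE] := dependent_choice_fun H; exists b; split=> // u.
apply: dual_ext => v; have [h hE] := linear_of_dual u.
have [e eE] := @dual_eval 'rV[R]_m v.
rewrite -[RHS]eE -[LHS]hE {1}(row_sum_delta v) !linear_sum.
by apply: eq_bigr => j _; rewrite !linearZ /= eE bE hE; exact: mulrC.
Qed.

Lemma dual_row_retract m : exists (r : {linear dual 'rV[R]_m -> 'rV[R]_m})
  (h : {linear 'rV[R]_m -> dual 'rV[R]_m}), forall u, h (r u) = u.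
Proof.
have [b [_ bS]] := dual_row_basis m.
have [ev evE] := dependent_choice_fun
  (fun j : 'I_m => @dual_eval 'rV[R]_m (delta_mx 0 j)).
have [r rE] := linear_row ev; have [h hE] := linear_row_comb b.
exists r, h => u; rewrite hE [RHS]bS.
by apply: eq_bigr => j _; rewrite rE evE.
Qed.

Lemma projective_dual_row m : projective (dual 'rV[R]_m).
Proof.
have [r [h hr]] := dual_row_retract m.
exact: (projective_retract hr (@projective_row R m)).
Qed.

Lemma fin_gen_dual_row m : fin_gen (dual 'rV[R]_m).
Proof.
have [r [h hr]] := dual_row_retract m.
by apply: (fin_gen_surj (f := h)); [move=> u; exists (r u) | apply: fin_gen_row].
Qed.

Definition fg_gorenstein M := fin_gen M /\ gorenstein_projective M.

(** An embedding [i] of [M] in a projective factors as [f] followed by [h] through a finite free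
    module. Then [f] is injective, and maps extend along [f] because they extend along [i] and can
    be pulled back by [h]; hence the cokernel of [f] is Gorenstein projective. *)
Lemma fg_gorenstein_step M : fg_gorenstein M ->
  exists m N (f : {linear M -> 'rV[R]_m}) (g : {linear 'rV[R]_m -> N}),
    [/\ fg_gorenstein N, ses f g & extends f].
Proof.
move=> [fgM gM].
have [_ [P [Y [i [q [pP gY iq]]]]] _] := gorenstein_projective_class gM.
have [ii _ _] := iq.
have [m [f [h hf]]] := fin_gen_factor i fgM pP.
have [N [g [gs gE]]] := cokernel_exists f.
have fg : ses f g by split=> // x y e; apply: ii; rewrite -!hf e.
have fext : extends f.
  move=> Q pQ k; have [evY _ _] := gorenstein_projective_class gY.
  have [l lE] := evY _ _ _ _ iq Q pQ k.
  by exists (l \o h : {linear 'rV[R]_m -> Q}) => x; rewrite /= hf lE.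
exists m, N, f, g; split=> //; split.
  exact: fin_gen_surj gs (fin_gen_row _ _).
apply: (gorenstein_projective_coker fg) => //.
exact/projective_gorenstein/projective_row.
Qed.

Lemma fg_gorenstein_torsionless M x : fg_gorenstein M ->
  (forall u : dual M, dual_val u x = 0) -> x = 0.
Proof.
move=> /fg_gorenstein_step[m [N [f [g [_ [fi _ _] _]]]]] ux.
apply: (inj_eq0 fi); apply/rowP => j; rewrite mxE.
have [c cE] := @linear_coord R m j.
have [u uE] := dual_of_linear (c \o f : {linear M -> R^o}).
by rewrite -cE; have := uE x; rewrite ux /= => <-.
Qed.

Lemma fin_gen_dual M : fg_gorenstein M -> fin_gen (dual M).
Proof.
move=> /fg_gorenstein_step[m [N [f [g [_ fg fext]]]]].
have [f' fE] := dual_map f; have [g' gE] := dual_map g.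
have [_ fs _] := dual_ses fg fext fE gE.
exact: fin_gen_surj fs (fin_gen_dual_row _).
Qed.

(** Pulled back to the dual of the free module, [phi] is evaluation at a point [y], read off on the
    dual basis. All functionals on [N] vanish at [g y], so [g y = 0] as [N] is torsionless, and [y]
    comes from [M]. *)
Lemma fg_gorenstein_reflexive M (phi : {linear dual M -> R^o}) : fg_gorenstein M ->
  exists x, forall u, phi u = dual_val u x.
Proof.
move=> /fg_gorenstein_step[m [N [f [g [gN fg fext]]]]].
have [f' fE] := dual_map f; have [g' gE] := dual_map g.
have fg' := dual_ses fg fext fE gE; have [_ fs _] := fg'; have [_ _ gk] := fg.
have [b [bE bS]] := dual_row_basis m.
pose y : 'rV[R]_m := \row_j phi (f' (b j)).
have yE u : dual_val u y = phi (f' u).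
  have [e eE] := @dual_eval 'rV[R]_m y.
  rewrite -eE (bS u) !linear_sum; apply: eq_bigr => j _.
  by rewrite !linearZ /= eE bE mxE.
have /gk[x xE] : g y = 0.
  apply: (fg_gorenstein_torsionless gN) => u.
  by rewrite -gE yE (ses_comp0 _ fg') linear0.
exists x => u; have [v <-] := fs u.
by rewrite fE xE yE.
Qed.

Lemma super_fp_of_class (S : lmodType R -> Prop) M :
  (forall X, S X -> exists P N (f : {linear N -> P}) (g : {linear P -> X}),
     [/\ fin_gen P, projective P, S N & ses f g]) ->
  S M -> super_fp M.
Proof.
move=> SS SM.
pose joined X Y := exists P (f : {linear Y -> P}) (g : {linear P -> X}),
  (fin_gen P /\ projective P) /\ ses f g.
have [next nextE] : exists next : {X | S X} -> {X | S X},
    forall E, joined (sval E) (sval (next E)).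
  apply: (dependent_choice_fun (P := fun E F => joined (sval E) (sval F))).
  case=> X SX; have [P [Y [f [g [fP pP SY fg]]]]] := SS _ SX.
  by exists (exist _ Y SY), P, f, g.
pose X n := sval (iter n next (exist _ M SM)).
have XE n : joined (X n) (X n.+1) by apply: nextE.
have [P XE1] := dependent_choice_fun XE.
have [f XE2] := dependent_choice_fun XE1.
have [g XE3] := dependent_choice_fun XE2.
have fg i : ses (f i) (g i) by case: (XE3 i).
exists P, (fun i => f i \o g i.+1 : {linear P i.+1 -> P i}), (g 0%N); split.
- by move=> i; case: (XE3 i).
- by case: (fg 0%N).
- move=> x; have [_ _ gE] := fg 0%N; have [_ gs _] := fg 1%N.
  split=> [/gE[y <-]|[y <-]]; last by rewrite /= (ses_comp0 _ (fg 0%N)).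
  by have [z <-] := gs y; exists z.
- move=> i x; have [fi _ _] := fg i; have [_ _ gE] := fg i.+1.
  have [_ gs _] := fg i.+2; split=> /= [/(inj_eq0 fi)/gE[y <-]|[y <-]].
    by have [z <-] := gs y; exists z.
  by rewrite (ses_comp0 _ (fg i.+1)) linear0.
Qed.

(** The class of modules isomorphic to such duals is closed under the syzygies given by dualizing
    [fg_gorenstein_step]. Working up to isomorphism lets the result reach a module identified with
    its bidual. *)
Lemma super_fp_dual M N (phi : {linear dual M -> N}) :
  fg_gorenstein M -> injective phi -> onto phi -> super_fp N.
Proof.
move=> gM phi_i phi_s.
apply: (@super_fp_of_class (fun N => exists M (phi : {linear dual M -> N}),
  [/\ fg_gorenstein M, injective phi & onto phi])); last by exists M, phi.
move=> {M N phi gM phi_i phi_s} X [M [phi [gM phi_i phi_s]]].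
have [m [N [f [g [gN fg fext]]]]] := fg_gorenstein_step gM.
have [f' fE] := dual_map f; have [g' gE] := dual_map g.
have [gi fs fk] := dual_ses fg fext fE gE.
exists (dual 'rV[R]_m), (dual N), g', (phi \o f' : {linear dual 'rV[R]_m -> X}).
split; [exact: fin_gen_dual_row | exact: projective_dual_row | |].
  by exists N, idfun; split=> // y; exists y.
split=> // [y|y] /=.
  by have [u <-] := phi_s y; have [v <-] := fs u; exists v.
rewrite -fk; split=> [|->]; last by rewrite linear0.
exact: inj_eq0.
Qed.

(* [dual N] is finitely generated, so a map from it to a projective passes
   through a finite free module; its coordinates are evaluations because [N]
   is reflexive, and evaluations lift along [g]. *)
Lemma dual_extends m N (g : {linear 'rV[R]_m -> N})
    (g' : {linear dual N -> dual 'rV[R]_m}) :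
  fg_gorenstein N -> onto g ->
  (forall u x, dual_val (g' u) x = dual_val u (g x)) -> extends g'.
Proof.
move=> gN gs gE Q pQ h.
have [n [k [l kl]]] := fin_gen_factor h (fin_gen_dual gN) pQ.
have H (j : 'I_n) : exists ev : {linear dual 'rV[R]_m -> R^o},
    forall u, ev (g' u) = k u 0 j.
  have [c cE] := @linear_coord R n j.
  have [x xE] := fg_gorenstein_reflexive (c \o k : {linear dual N -> R^o}) gN.
  have [y yE] := gs x; have [ev evE] := @dual_eval 'rV[R]_m y.
  by exists ev => u; rewrite evE gE yE -xE /= cE.
have [ev evE] := dependent_choice_fun H.
have [r rE] := linear_row ev.
exists (l \o r : {linear dual 'rV[R]_m -> Q}) => u /=.
by rewrite -kl; congr (l _); apply/rowP => j; rewrite rE evE.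
Qed.

Lemma gpd_le_dual n M : fg_gorenstein M -> gpd_le n (dual M) ->
  gorenstein_projective (dual M).
Proof.
elim: n M => // n IH M gM gpdM.
have [m [N [f [g [gN fg fext]]]]] := fg_gorenstein_step gM.
have [f' fE] := dual_map f; have [g' gE] := dual_map g.
have fg' := dual_ses fg fext fE gE; have [_ gs _] := fg.
apply: (gorenstein_projective_coker fg').
- exact: dual_extends gE.
- apply: IH gN _; apply: (gpd_le_syzygy fg') => //; exact: projective_dual_row.
- exact/projective_gorenstein/projective_dual_row.
Qed.

End Duality.

Unset Implicit Arguments.

Theorem theorem3p2 (R : comPzRingType) (M : lmodType R) :
  fin_gen M -> gorenstein_projective M -> finite_Gpd (dual M) ->
  super_fp M /\ gorenstein_projective (dual M).
Proof.
move=> fgM gM [n /Gpd_le_gpd_le gpdM].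
have hM : fg_gorenstein M by [].
have gD := gpd_le_dual hM gpdM; split=> //.
have hD : fg_gorenstein (dual M) by split=> //; apply: fin_gen_dual.
have H (phi : dual (dual M)) : exists x, forall u : dual M, dual_val phi u = dual_val u x.
  have [h hE] := linear_of_dual phi.
  by have [x xE] := fg_gorenstein_reflexive h hM; exists x => u; rewrite -hE xE.
have sep x y : (forall u : dual M, dual_val u x = dual_val u y) -> x = y.
  move=> e; apply/eqP; rewrite -subr_eq0; apply/eqP.
  apply: (fg_gorenstein_torsionless hM) => u.
  by have [f fE] := linear_of_dual u; rewrite -fE linearB !fE e subrr.
(* The inverse of the evaluation map from [M] to its bidual: reflexivity supplies the values, and
   separation by functionals gives linearity. This direction is needed because [super_fp_dual]
   expects an isomorphism out of a dual, here the dual of [dual M]. *)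
have [d dE] := dependent_choice_fun H.
have [|phi phiE] := @linear_exists R (dual (dual M)) M d.
  move=> c a b; apply: sep => u; have [f fE] := linear_of_dual u.
  by rewrite -dE dual_valP !dE -!fE linearP.
apply: (super_fp_dual (phi := phi)) => //.
- move=> a b e; apply: dual_ext => u.
  by rewrite !dE -!phiE e.
- move=> x; have [ev evE] := dual_eval x; have [a aE] := dual_of_linear ev.
  by exists a; apply: sep => u; rewrite phiE -dE aE evE.
Qed.
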